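(* Let $X$ be a Tychonoff space, let $\mathcal{P}\subseteq\mathcal{M}(X)$ be an algebraic set of maximal ideals of $C(X)$, let $Y$ be a space homeomorphic with $X$, and let $\mathcal{Q}\subseteq\mathcal{M}(Y)$ be the conjugate of $\mathcal{P}$ in $C(Y)$. If $X$ is locally-$\mathcal{P}$, then $Y$ is locally-$\mathcal{Q}$.
   Context: For a space $X$, $C(X)$ is the ring of real-valued continuous functions on $X$, $C^*(X)$ is its subring of bounded functions, and $\mathcal{M}(X)$ is the set of all maximal ideals of $C(X)$. An intermediate subring $A(X)$ of $C(X)$ is a subring with $C^*(X)\subseteq A(X)\subseteq C(X)$; $\mathcal{M}(A)$ is the set of all maximal ideals of $A(X)$. Isomorphism means ring isomorphism. Conjugates and algebraic sets. For a ring isomorphism $\sigma:A(X)\to B(Y)$ between intermediate subrings of $C(X)$ and $C(Y)$ and $\mathcal{E}\subseteq\mathcal{M}(A)$, put $\sigma^*(\mathcal{E})=\{\sigma(M):M\in\mathcal{E}\}\subseteq\mathcal{M}(B)$. A set $\mathcal{Q}\subseteq\mathcal{M}(B)$ is conjugate of $\mathcal{P}\subseteq\mathcal{M}(A)$ if $\sigma^*(\mathcal{P})=\mathcal{Q}$ for every isomorphism $\sigma:A(X)\to B(Y)$. A set $\mathcal{P}\subseteq\mathcal{M}(A)$ is algebraic if, for every Tychonoff space $Y$ and every intermediate subring $B(Y)$ of $C(Y)$ isomorphic with $A(X)$, there exists $\mathcal{Q}\subseteq\mathcal{M}(B)$ which is conjugate of $\mathcal{P}$. (When $A(X)$ and $B(Y)$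 are isomorphic, the conjugate is unique.) Here these notions are used with $A(X)=C(X)$ and $B(Y)=C(Y)$. For $x\in X$ let $M_x=\{f\in C(X): f(x)=0\}$. For $\mathcal{P}\subseteq\mathcal{M}(X)$, $X$ is locally-$\mathcal{P}$ if $M_x\in\mathcal{P}$ for every $x\in X$; similarly for $Y$ and subsets of $\mathcal{M}(Y)$. *)

(* Defs.v *)
From HB Require Import structures.
From mathcomp Require Export all_boot all_order all_algebra.
From mathcomp Require Export all_classical all_reals all_analysis.
Import GRing.Theory.
Export numFieldNormedType.Exports.

Set Implicit Arguments.
Unset Strict Implicit.
Unset Printing Implicit Defensive.

Local Open Scope classical_set_scope.
Local Open Scope ring_scope.

(* Mathcomp-Analysis states completely_regular_space with uniform_separator;
   by uniform_separatorP this is the separation of a point from a closed set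
   not containing it by a continuous function into [0, 1]. *)
Definition tychonoff_space (X : topologicalType) : Prop :=
  completely_regular_space X /\ hausdorff_space X.

Definition homeomorphic (X Y : topologicalType) : Prop :=
  exists (h : X -> Y) (k : Y -> X),
    [/\ cancel h k, cancel k h, continuous h & continuous k].

(* C(X) is continuousType X R with its pointwise operations, obtained as a
   subring of X -> R. The space X may be empty, in which case C(X) is the zero
   ring; hence comPzRingType and not comNzRingType. *)
Section ContinuousRing.
Context (X : topologicalType) (R : realType).

Definition continuous_pred : {pred X -> R} :=
  mem [set f : X -> R | continuous f].

Definition continuous_sub (f : X -> R) (fP : f \in continuous_pred) :
    continuousType X R :=
  mkcts (set_mem fP).

Lemma continuous_sub_rect (K : continuousType X R -> Type) :
  (forall f (fP : f \in continuous_pred), K (continuous_sub fP)) ->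
  forall u, K u.
Proof.
move=> Ksub u; have uP : (u : X -> R) \in continuous_pred.
  by apply: mem_set => /=; exact: cts_fun.
suff -> : u = continuous_sub uP by exact: Ksub.
by apply/continuousEP => x.
Qed.

Lemma continuous_subE f (fP : f \in continuous_pred) :
  continuous_sub fP = f :> (X -> R).
Proof. by []. Qed.

HB.instance Definition _ :=
  isSub.Build (X -> R) continuous_pred (continuousType X R)
    continuous_sub_rect continuous_subE.

Lemma continuous_subring_closed : subring_closed continuous_pred.
Proof.
split=> [|f g|f g]; rewrite !inE /=.
- by move=> x; exact: cvg_cst.
- by move=> fc gc x; apply: cvgB; [exact: fc|exact: gc].
- by move=> fc gc x; apply: cvgM; [exact: fc|exact: gc].
Qed.

HB.instance Definition _ :=
  GRing.SubChoice_isSubComPzRing.Build (X -> R) continuous_pred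
    (continuousType X R) continuous_subring_closed.

End ContinuousRing.

Section MaximalIdeals.
Context (A : comPzRingType).

Definition is_ideal (I : set A) : Prop :=
  [/\ I 0, forall a b, I a -> I b -> I (a + b) & forall a b, I b -> I (a * b)].

Definition is_maximal_ideal (M : set A) : Prop :=
  [/\ is_ideal M, M != setT &
      forall I, is_ideal I -> M `<=` I -> I = M \/ I = setT].

Definition maximal_ideals : set (set A) := [set M | is_maximal_ideal M].

End MaximalIdeals.
Arguments maximal_ideals A : clear implicits.

Definition ideals_image (A B : comPzRingType) (s : A -> B) (E : set (set A)) :
    set (set B) :=
  [set s @` M | M in E].

Definition conjugate_of (A B : comPzRingType)
    (Q : set (set B)) (P : set (set A)) : Prop :=
  forall s : {rmorphism A -> B}, bijective s -> ideals_image s P = Q.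

Definition ring_isomorphic (A B : comPzRingType) : Prop :=
  exists s : {rmorphism A -> B}, bijective s.

Definition algebraic (R : realType) (X : topologicalType)
    (P : set (set (continuousType X R))) : Prop :=
  forall Y : topologicalType, tychonoff_space Y ->
    ring_isomorphic (continuousType X R) (continuousType Y R) ->
    exists2 Q, Q `<=` maximal_ideals (continuousType Y R) & conjugate_of Q P.

Definition fixed_ideal (R : realType) (X : topologicalType) (x : X) :
    set (continuousType X R) :=
  [set f : continuousType X R | f x = 0].

Definition is_locally (R : realType) (X : topologicalType)
    (P : set (set (continuousType X R))) : Prop :=
  forall x : X, P (fixed_ideal x).

(* Main.v *)
(* A homeomorphism k : Y -> X induces the ring isomorphism f |-> f \o k of C(X)
   onto C(Y), which maps M_(k y) onto M_y. As Q is the image of P under every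
   isomorphism, M_(k y) in P gives M_y in Q. *)
From HB Require Import structures.
Require Import Defs.
Import GRing.Theory.

Local Open Scope classical_set_scope.
Local Open Scope ring_scope.

(** The map [k] is bundled with its continuity, so that [f \o k] is inferred to be continuous and
    the morphism structures below can depend on [k] alone. *)
Definition pullback (R : realType) (X Y : topologicalType)
    (k : continuousType Y X) (f : continuousType X R) : continuousType Y R :=
  f \o k.
Arguments pullback {R X Y} k f.

Lemma pullback_zmod_morphism (R : realType) (X Y : topologicalType)
  (k : continuousType Y X) : zmod_morphism (@pullback R X Y k).
Proof. by move=> f g; apply/continuousEP => y. Qed.

Lemma pullback_monoid_morphism (R : realType) (X Y : topologicalType)
  (k : continuousType Y X) : monoid_morphism (@pullback R X Y k).
Proof. by split=> [|f g]; apply/continuousEP => y. Qed.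

HB.instance Definition _ (R : realType) (X Y : topologicalType)
    (k : continuousType Y X) :=
  GRing.isZmodMorphism.Build _ _ (@pullback R X Y k)
    (@pullback_zmod_morphism R X Y k).

HB.instance Definition _ (R : realType) (X Y : topologicalType)
    (k : continuousType Y X) :=
  GRing.isMonoidMorphism.Build _ _ (@pullback R X Y k)
    (@pullback_monoid_morphism R X Y k).

(** Pulling back is contravariant: the composite of the two maps sends [f] to [f \o k \o h], and
    [k \o h] is the identity of [X]. *)
Lemma pullbackK (R : realType) (X Y : topologicalType)
    (h : continuousType X Y) (k : continuousType Y X) :
  cancel h k -> cancel (@pullback R X Y k) (pullback h).
Proof. by move=> hK f; apply/continuousEP => x /=; rewrite hK. Qed.

Lemma pullback_fixed_ideal (R : realType) (X Y : topologicalType)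
    (h : continuousType X Y) (k : continuousType Y X) (y : Y) :
  cancel h k -> cancel k h ->
  pullback k @` fixed_ideal (k y) = fixed_ideal y :> set (continuousType Y R).
Proof.
(* The forward inclusion is a computation: [pullback k f] at [y] is [f (k y)]. *)
move=> hK kK; apply/seteqP; split=> [_ [f fky <-] //|g gy].
(* The preimage [g \o h] vanishes at [k y] because [h (k y) = y]. *)
by exists (pullback h g); [rewrite /fixed_ideal /= kK|exact: pullbackK].
Qed.

Theorem theorem3p6 (R : realType) (X Y : topologicalType)
  (P : set (set (continuousType X R))) (Q : set (set (continuousType Y R))) :
  tychonoff_space X ->
  P `<=` maximal_ideals (continuousType X R) ->
  algebraic P ->
  homeomorphic X Y ->
  Q `<=` maximal_ideals (continuousType Y R) ->
  conjugate_of Q P ->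
  is_locally P ->
  is_locally Q.
Proof.
move=> _ _ _ [h [k [hK kK hc kc]]] _ QP PX y.
pose h' : continuousType X Y := mkcts hc.
pose k' : continuousType Y X := mkcts kc.
have bij : bijective (@pullback R X Y k').
  (* The two inverse laws are [pullbackK] for [h'], [k'] and with their roles exchanged. *)
  by exists (pullback h'); exact: pullbackK.
rewrite -(QP (@pullback R X Y k') bij).
(* The goal is now a member of [P] with image [fixed_ideal y]; the point of [X] matching [y]
   supplies it. *)
by exists (fixed_ideal (k y)); [exact: PX|exact: (@pullback_fixed_ideal R X Y h' k')].
Qed.
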